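(* Let $k,t,\omega$ be integers with $k=\omega$, $k\geq 4$ and $t\geq\omega+1$. Then $$\operatorname{gr}_k(P_5:PA_{t,\omega})=(\omega-1)(t-1)+1 .$$
   Context: All graphs are finite, simple and undirected. $K_n$ is the complete graph on $n$ vertices and $P_5$ is the path with $5$ vertices and $4$ edges. For $t\geq\omega+1$, the pineapple $PA_{t,\omega}$ is the graph of order $t$ obtained from the complete graph $K_\omega$ by attaching $t-\omega$ pendent vertices to one and the same vertex of $K_\omega$. A $k$-edge-coloring assigns to each edge one of $k$ colors; all $k$-edge-colorings are assumed exact, i.e. each of the $k$ colors is used at least once. An edge-colored graph is rainbow if all its edges have different colors and monochromatic if all its edges have a single color. A copy of a graph means a (not necessarily induced) subgraph isomorphic to it. For non-empty graphs $G,H$ (graphs with at least one edge) and a positive integer $k$, the Gallai-Ramsey number $\operatorname{gr}_k(G:H)$ is the minimum integer $N$ with $\binom{N}{2}\geq k$ (so that $K_N$ admits a $k$-edge-coloring) such that for all $n\geq N$, every $k$-edge-coloring of $K_n$ contains either a rainbow copy of $G$ or a monochromatic copy of $H$. *)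

(* Defs.v *)
From mathcomp Require Import all_boot.
Set Implicit Arguments.
Unset Strict Implicit.
Unset Printing Implicit Defensive.

Record sgraph := SGraph {
  vertex :> finType;
  adj : rel vertex;
  adj_sym : symmetric adj;
  adj_irr : irreflexive adj }.

Definition edges (G : sgraph) : {set {set G}} :=
  [set e : {set G} | [exists x, exists y, adj x y && (e == [set x; y])]].

Definition complete_adj n (i j : 'I_n) : bool := i != j.

Lemma complete_sym n : symmetric (@complete_adj n).
Proof. by move=> i j; rewrite /complete_adj eq_sym. Qed.

Lemma complete_irr n : irreflexive (@complete_adj n).
Proof. by move=> i; rewrite /complete_adj eqxx. Qed.

Definition complete_graph n := SGraph (@complete_sym n) (@complete_irr n).

(* [path_graph n] has n vertices, hence n - 1 edges. *)
Definition path_adj n (i j : 'I_n) : bool := (i.+1 == j) || (j.+1 == i).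

Lemma path_sym n : symmetric (@path_adj n).
Proof. by move=> i j; rewrite /path_adj orbC. Qed.

Lemma path_irr n : irreflexive (@path_adj n).
Proof. by move=> i; rewrite /path_adj orbb gtn_eqF. Qed.

Definition path_graph n := SGraph (@path_sym n) (@path_irr n).

(* Vertices 0, ..., w - 1 span the clique K_w; the remaining vertices
   w, ..., t - 1 are pendent, all attached to the clique vertex 0. Meaningful
   when 0 < w <= t. *)
Definition pineapple_adj t w (i j : 'I_t) : bool :=
  (i != j) && [|| (i < w) && (j < w),
                 (i == 0 :> nat) && (w <= j) |
                 (j == 0 :> nat) && (w <= i)].

Lemma pineapple_sym t w : symmetric (@pineapple_adj t w).
Proof.
move=> i j; rewrite /pineapple_adj eq_sym [(i < w) && _]andbC.
by rewrite [(_ && (w <= j)) || _]orbC.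
Qed.

Lemma pineapple_irr t w : irreflexive (@pineapple_adj t w).
Proof. by move=> i; rewrite /pineapple_adj eqxx. Qed.

Definition pineapple t w := SGraph (@pineapple_sym t w) (@pineapple_irr t w).

(* A k-edge-coloring of F is given by c : {set F} -> 'I_k, of which only the
   values on [edges F] are ever used. *)
Definition exact_coloring (F : sgraph) k (c : {set F} -> 'I_k) : Prop :=
  forall a : 'I_k, exists2 e, e \in edges F & c e = a.

(* f embeds G in F as a not necessarily induced subgraph. *)
Definition is_copy (F G : sgraph) (f : G -> F) : Prop :=
  injective f /\ forall x y : G, adj x y -> adj (f x) (f y).

Definition has_rainbow_copy (F G : sgraph) k (c : {set F} -> 'I_k) : Prop :=
  exists2 f : G -> F, is_copy f &
    {in edges G &, injective (fun e : {set G} => c (f @: e))}.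

Definition has_mono_copy (F H : sgraph) k (c : {set F} -> 'I_k) : Prop :=
  exists2 f : H -> F, is_copy f &
    exists a : 'I_k, forall e : {set H}, e \in edges H -> c (f @: e) = a.

Definition gallai_ramsey_bound k (G H : sgraph) (N : nat) : Prop :=
  k <= 'C(N, 2) /\
  forall n, N <= n -> forall c : {set complete_graph n} -> 'I_k,
    exact_coloring c -> has_rainbow_copy G c \/ has_mono_copy H c.

(* [is_gallai_ramsey k G H N] is gr_k(G : H) = N, for G and H with at least one
   edge and 0 < k. *)
Definition is_gallai_ramsey k (G H : sgraph) (N : nat) : Prop :=
  gallai_ramsey_bound k G H N /\
  forall M, gallai_ramsey_bound k G H M -> N <= M.

(* Main.v *)
Require Import Defs.
From mathcomp Require Import all_boot zify.
Set Implicit Arguments.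
Unset Strict Implicit.
Unset Printing Implicit Defensive.

(* Lower bound: split (omega - 1)(t - 1) vertices into omega - 1 blocks of size
   t - 1, give each block its own color, and use the last color between blocks.

   Upper bound: call two edges at a common vertex with different colors a
   cherry, and join two colors when they form a cherry. In a coloring with at
   least four colors this graph on the colors is either a star or has two
   disjoint edges.
   - A star means that some color is dominant: for the other colors j, the sets
     V(j) of vertices incident with j are pairwise disjoint, and everything
     outside or between them has the dominant color. The pineapple is then found
     by pigeonhole on the V(j).
   - Otherwise two cherries carry four different colors. Two such cherries
     cannot be vertex-disjoint without creating a rainbow P5, and a short case
     analysis of how they may overlap shows that no cherry at all lives outside
     their at most six vertices; the remaining vertices span a monochromatic
     clique on at least t vertices. *)

(** * Case splitting on coincidences among four values *)

Lemma not_uniq4 (T : eqType) (a b c d : T) : ~~ uniq [:: a; b; c; d] ->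
  a = b \/ a = c \/ a = d \/ b = c \/ b = d \/ c = d.
Proof.
rewrite /= !inE !negb_or !andbT !negb_and !negbK.
by case/or3P=> [/or3P[]|/orP[]|] /eqP; tauto.
Qed.

Ltac uniq_hyp :=
  rewrite /= ?inE ?negb_or;
  repeat match goal with
  | |- is_true (_ && _) -> _ => case/andP
  | |- is_true (_ != _) -> _ => move/eqP=> ?
  | |- is_true true -> _ => move=> _
  | |- _ => progress rewrite ?inE ?negb_or
  end.

Ltac uniq_goal :=
  rewrite /= ?inE ?negb_or; repeat (apply/andP; split); try exact: isT;
  apply/eqP; first [assumption | apply: nesym; assumption | congruence].

(** * Pairs of cherries in colorings without a rainbow P5 *)

Section RainbowP5Free.

Variables (V C : finType) (col : V -> V -> C).
Hypothesis colC : forall x y, col x y = col y x.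
Hypothesis noP5 : forall a b c d e, uniq [:: a; b; c; d; e] ->
  ~~ uniq [:: col a b; col b c; col c d; col d e].

(* Splits on which two edges of the path [a b c d e] share their color,
   discarding the branches inconsistent with the colors known so far. *)
Ltac path5 a b c d e :=
  move: (colC a b) (colC b c) (colC c d) (colC d e);
  (have /noP5/not_uniq4 : uniq [:: a; b; c; d; e] by uniq_goal);
  move=> [|[|[|[|[|]]]]]; intros; try congruence.

Lemma disjoint_cherries u x y v z w :
    uniq [:: u; x; y; v; z; w] ->
  ~~ uniq [:: col u x; col u y; col v z; col v w].
Proof.
uniq_hyp; apply/negP; rewrite /not; uniq_hyp.
(* The paths [u x z v w] and [y u x z v] leave only the colors of [u x] and [v z] for [x z]. Either
   choice fixes the colors of further edges, until [v y] or [z w] has no color left. *)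
have [xz | /eqP xz'] := eqVneq (col x z) (col u x); last first.
  have xz : col x z = col v z by path5 u x z v w; path5 y u x z v.
  have yw : col y w = col u y by path5 u y w v z; path5 x u y w v; path5 z x u y w.
  have xv : col x v = col u y by path5 u x v w y; path5 y u x v z; path5 y w v x z.
  have uz : col u z = col v w by path5 u z x v w; path5 x u z v w; path5 z u x v w.
  by path5 u z x v y; path5 x u y v z; path5 x u y v w; path5 x u z v y.
have yw : col y w = col v w by path5 u y w v z; path5 x u y w v; path5 x z v w y.
have yv : col y v = col u x by path5 u y v z x; path5 x u y v w; path5 x z v y w.
have uz : col u z = col v w by path5 u z v y w; path5 x z u y w; path5 y u z v w.
have xy : col x y = col v z by path5 u y x z v; path5 u z v y x; path5 x y u z v.
by path5 u x y w z; path5 u y x z w; path5 x u y w z; path5 x y u z w.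
Qed.

Ltac cherries u x y v z w :=
  (have /disjoint_cherries/not_uniq4 : uniq [:: u; x; y; v; z; w] by uniq_goal);
  move=> [|[|[|[|[|]]]]]; intros; try congruence.

(** Two colors at [p] meet at most two of the four star colors; the other two star edges then form a
    cherry contradicting [disjoint_cherries]. *)
Lemma star4_no_disjoint_cherry u a b c d p q r :
    uniq [:: u; a; b; c; d; p; q; r] ->
    uniq [:: col u a; col u b; col u c; col u d] ->
  col p q = col p r.
Proof.
uniq_hyp; uniq_hyp; apply/eqP/negPn/negP=> /eqP pqr.
by cherries u a b p q r; cherries u c d p q r; cherries u a c p q r;
   cherries u b d p q r; cherries u a d p q r; cherries u b c p q r.
Qed.

(** If [x w] has the color of [u y], four paths exclude every color for [u p]. Otherwise [x w] and
    [y w] both get the color of [v w], and then no color is left for [y q]. *)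
Lemma fork_cherry_false u x y v w p q r :
    uniq [:: u; x; y; v; w; p; q; r] ->
    uniq [:: col u x; col u y; col u v; col v w] ->
  col p q = col u v -> col p r = col u x -> False.
Proof.
uniq_hyp; uniq_hyp; move=> pq pr.
have [xw | /eqP xw'] := eqVneq (col x w) (col u y).
  by path5 x w v u p; path5 v w x u p; path5 w x u p q; path5 w v u p r.
have xw : col x w = col v w by path5 x w v u y; path5 y u x w v.
have yw : col y w = col v w by path5 x u y w v; path5 x u v w y; path5 x w y u v.
by path5 u y q p r; path5 w x u y q; path5 w y q p r; path5 w v u y q.
Qed.

Ltac by_config H := by apply: H; first [congruence | uniq_goal].

(* By [disjoint_cherries] the two colors of an outside cherry meet those of each
   cherry of the fork, so they are [col u v] and one of [col u x], [col u y].
   The paw and the 4-cycle below are treated in the same way. *)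
Lemma fork_no_disjoint_cherry u x y v w p q r :
    uniq [:: u; x; y; v; w; p; q; r] ->
    uniq [:: col u x; col u y; col u v; col v w] ->
  col p q = col p r.
Proof.
uniq_hyp; uniq_hyp; apply/eqP/negPn/negP=> /eqP pqr.
cherries u x y p q r; cherries u x v p q r; cherries u y v p q r;
  cherries v u w p q r.
all: first [ by_config (@fork_cherry_false u x y v w p q r)
           | by_config (@fork_cherry_false u x y v w p r q)
           | by_config (@fork_cherry_false u y x v w p q r)
           | by_config (@fork_cherry_false u y x v w p r q) ].
Qed.

(** The color of [u p] is forced, after which no color is left for [w q]. *)
Lemma paw_cherry_false u x y w p q r :
    uniq [:: u; x; y; w; p; q; r] ->
    uniq [:: col u x; col u y; col x y; col x w] ->
  col p q = col u x -> col p r = col x y -> False.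
Proof.
uniq_hyp; uniq_hyp; move=> pq pr.
have up : col u p = col x y by path5 x y u p q; path5 w x u p r; path5 w x y u p.
by path5 u y x w q; path5 u p q w x; path5 y u x w q; path5 y u p q w.
Qed.

Lemma paw_no_disjoint_cherry u x y w p q r :
    uniq [:: u; x; y; w; p; q; r] ->
    uniq [:: col u x; col u y; col x y; col x w] ->
  col p q = col p r.
Proof.
uniq_hyp; uniq_hyp; apply/eqP/negPn/negP=> /eqP pqr.
have := colC x u; have := colC y u; have := colC y x; intros.
cherries u x y p q r; cherries y u x p q r; cherries x y w p q r;
  cherries x u w p q r; cherries x u y p q r.
all: first [ by_config (@paw_cherry_false u x y w p q r)
           | by_config (@paw_cherry_false u x y w p r q) ].
Qed.

(** The color of [u p] is forced, after which no color is left for [v p]. *)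
Lemma cycle4_cherry_false u x v y p q r :
    uniq [:: u; x; v; y; p; q; r] ->
    uniq [:: col u x; col x v; col v y; col y u] ->
  col p q = col u x -> col p r = col v y -> False.
Proof.
uniq_hyp; uniq_hyp; move=> pq pr.
have up : col u p = col v y by path5 x v y u p; path5 v x u p r; path5 v y u p q.
by path5 u x v p r; path5 u y v p q; path5 x v p u y; path5 y u x v p.
Qed.

Lemma cycle4_no_disjoint_cherry u x v y p q r :
    uniq [:: u; x; v; y; p; q; r] ->
    uniq [:: col u x; col x v; col v y; col y u] ->
  col p q = col p r.
Proof.
uniq_hyp; uniq_hyp; apply/eqP/negPn/negP=> /eqP pqr.
have := colC x u; have := colC v x; have := colC y v; have := colC u y; intros.
cherries u x y p q r; cherries v x y p q r; cherries x u v p q r;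
  cherries y u v p q r.
all: first [ by_config (@cycle4_cherry_false u x v y p q r)
           | by_config (@cycle4_cherry_false u x v y p r q)
           | by_config (@cycle4_cherry_false x v y u p q r)
           | by_config (@cycle4_cherry_false x v y u p r q) ].
Qed.

(** The cases are the possible overlaps. A common center gives a star. A center that is a leaf of
    the other cherry gives a fork, or a paw if a further vertex is shared. Two common leaves give a
    4-cycle. A single common leaf gives a rainbow P5, and disjointness contradicts
    [disjoint_cherries]. *)
Lemma cherries_mono_outside u x y v z w p q r :
    u != x -> u != y -> v != z -> v != w ->
    uniq [:: col u x; col u y; col v z; col v w] ->
    uniq [:: p; q; r] -> all [predC [:: u; x; y; v; z; w]] [:: p; q; r] ->
  col p q = col p r.
Proof.
move=> /eqP ux /eqP uy /eqP vz /eqP vw; uniq_hyp; uniq_hyp; uniq_hyp.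
have [xy zw] : x <> y /\ z <> w by split; congruence.
move: (colC u x) (colC u y) (colC v z) (colC v w) => *.
have [uv | /eqP uv] := eqVneq u v.
  by subst v; apply: (@star4_no_disjoint_cherry u x y z w); uniq_goal.
have [uz | /eqP uz] := eqVneq u z.
  subst z; have [? ?] : v <> x /\ v <> y by split; congruence.
  have [wx | /eqP wx] := eqVneq w x.
    by subst w; apply: (@paw_no_disjoint_cherry x u v y); uniq_goal.
  have [wy | /eqP wy] := eqVneq w y.
    by subst w; apply: (@paw_no_disjoint_cherry y u v x); uniq_goal.
  by apply: (@fork_no_disjoint_cherry u x y v w); uniq_goal.
have [uw | /eqP uw] := eqVneq u w.
  subst w; have [? ?] : v <> x /\ v <> y by split; congruence.
  have [zx | /eqP zx] := eqVneq z x.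
    by subst z; apply: (@paw_no_disjoint_cherry x u v y); uniq_goal.
  have [zy | /eqP zy] := eqVneq z y.
    by subst z; apply: (@paw_no_disjoint_cherry y u v x); uniq_goal.
  by apply: (@fork_no_disjoint_cherry u x y v z); uniq_goal.
have [vx | /eqP vx] := eqVneq v x.
  subst x; have [yz | /eqP yz] := eqVneq y z.
    by subst z; apply: (@paw_no_disjoint_cherry u v y w); uniq_goal.
  have [yw | /eqP yw] := eqVneq y w.
    by subst w; apply: (@paw_no_disjoint_cherry u v y z); uniq_goal.
  by apply: (@fork_no_disjoint_cherry v z w u y); uniq_goal.
have [vy | /eqP vy] := eqVneq v y.
  subst y; have [xz | /eqP xz] := eqVneq x z.
    by subst z; apply: (@paw_no_disjoint_cherry u v x w); uniq_goal.
  have [xw | /eqP xw] := eqVneq x w.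
    by subst w; apply: (@paw_no_disjoint_cherry u v x z); uniq_goal.
  by apply: (@fork_no_disjoint_cherry v z w u x); uniq_goal.
have [xz | /eqP xz] := eqVneq x z.
  subst z; have [yw | /eqP yw] := eqVneq y w; last by path5 y u x v w.
  by subst w; apply: (@cycle4_no_disjoint_cherry u x v y); uniq_goal.
have [xw | /eqP xw] := eqVneq x w.
  subst w; have [yz | /eqP yz] := eqVneq y z; last by path5 y u x v z.
  by subst z; apply: (@cycle4_no_disjoint_cherry u x v y); uniq_goal.
have [yz | /eqP yz] := eqVneq y z; first by subst z; path5 x u y v w.
have [yw | /eqP yw] := eqVneq y w; first by subst w; path5 x u y v z.
by cherries u x y v z w.
Qed.

End RainbowP5Free.

(** * Relations whose edges pairwise intersect *)

(** Pairwise meeting edges form a star or a triangle. The triangle is excluded: a fourth element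
    lies on an edge, which cannot meet all three sides. *)
Lemma intersecting_rel_star (C : finType) (H : rel C) :
    symmetric H -> irreflexive H -> (forall i, exists j, H i j) -> 3 < #|C| ->
    (forall i j k l, H i j -> H k l -> ~~ uniq [:: i; j; k; l]) ->
  exists a, forall i j, H i j -> i = a \/ j = a.
Proof.
move=> symH irrH nbr cardC4 meet.
have neqH i j : H i j -> i <> j by move=> Hij ij; rewrite ij irrH in Hij.
have Hmeet i j k l : H i j -> H k l -> k = i \/ k = j \/ l = i \/ l = j.
  move=> Hij Hkl; have := neqH _ _ Hij; have := neqH _ _ Hkl.
  by case/not_uniq4: (meet _ _ _ _ Hij Hkl) => [|[|[|[|[|]]]]] *; intuition congruence.
have star_or a : (forall i j, H i j -> i = a \/ j = a) \/
    exists i j, [/\ H i j, i <> a & j <> a].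
  have [/forallP Ha | ] := boolP [forall i, forall j, H i j ==> (i == a) || (j == a)].
    by left=> i j Hij; move/forallP/(_ j)/implyP/(_ Hij)/orP: (Ha i) => [] /eqP; auto.
  rewrite negb_forall => /existsP[i]; rewrite negb_forall => /existsP[j].
  rewrite negb_imply negb_or => /andP[Hij /andP[/eqP ia /eqP ja]].
  by right; exists i, j.
have /card_gt0P[i _] : 0 < #|C| by lia.
have [j Hij] := nbr i.
have [Hi | [k' [l' [Hkl' ki' li']]]] := star_or i; first by exists i.
(* An edge avoiding [i] must meet [i j] in [j]. *)
have [k Hjk ki] : exists2 k, H j k & k <> i.
  case: (Hmeet _ _ _ _ Hij Hkl') => [//|[e|[//|e]]]; subst j; first by exists l'.
  by exists k'; rewrite 1?symH.
have [Hj | [m' [l [Hml mj lj]]]] := star_or j; first by exists j.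
(* An edge avoiding [j] meets [i j] in [i] and [j k] in [k]. *)
have Hik : H i k.
  case: (Hmeet _ _ _ _ Hij Hml) => [|[|[|]]] ? //; subst i;
  case: (Hmeet _ _ _ _ Hjk Hml) => [|[|[|]]] ? //; subst => //; by rewrite symH.
have [m] : exists m, m \notin [:: i; j; k].
  apply/existsP; apply: contraLR cardC4 => /existsPn sub.
  rewrite -leqNgt (leq_trans _ (card_size [:: i; j; k])) // subset_leq_card //.
  by apply/subsetP=> m _; apply: negbNE (sub m).
rewrite !inE !negb_or => /and3P[/eqP mi /eqP mj' /eqP mk].
have [n Hmn] := nbr m; exfalso.
have := neqH _ _ Hij; have := neqH _ _ Hjk; have := neqH _ _ Hik.
have := Hmeet _ _ _ _ Hij Hmn; have := Hmeet _ _ _ _ Hjk Hmn.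
have := Hmeet _ _ _ _ Hik Hmn; intuition congruence.
Qed.

(** * The dichotomy for colorings, and pineapples in a dominant color *)

Section GallaiRamsey.

Variables (V C : finType) (col : V -> V -> C).
Hypothesis colC : forall x y, col x y = col y x.

Definition dominant_color (a : C) := forall u x y,
  u != x -> u != y -> col u x != col u y -> col u x = a \/ col u y = a.

Definition monochromatic_on (A : {set V}) (a : C) :=
  {in A &, forall p q, p != q -> col p q = a}.

Definition color_adj a (x y : V) := (x != y) && (col x y == a).

(** [z] is the vertex carrying the pendent vertices and [K] the rest of the clique. The pendent
    vertices are only counted: [K] takes [w.-1] of the neighbors of [z] in color [a], so at least
    [t - w] remain. *)
Definition pineapple_witness t w a := exists z K,
  [/\ size K = w.-1, pairwise (color_adj a) (z :: K)
    & t.-1 <= #|[set y | color_adj a z y]|].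

Lemma mono_set_pineapple t w (A : {set V}) a :
  monochromatic_on A a -> 0 < w <= t -> t <= #|A| -> pineapple_witness t w a.
Proof.
move=> mono /andP[w0 wt] tA.
have adjA : pairwise (color_adj a) (enum A).
  rewrite (@sub_in_pairwise _ [in A] [rel x y | x != y]) -?uniq_pairwise ?enum_uniq //.
  - by move=> x y xA yA /= xy; rewrite /color_adj xy mono /=.
  - by apply/allP=> x; rewrite mem_enum.
case defA: (enum A) adjA => [|z s] adjA; first by move: tA; rewrite cardE defA /=; lia.
have szs : (size s).+1 = #|A| by rewrite cardE defA.
exists z, (take w.-1 s); split.
- by rewrite size_takel //; lia.
- by apply: subseq_pairwise adjA; rewrite /= eqxx take_subseq.
have zA : z \in A by rewrite -mem_enum defA mem_head.
have := cardsD1 z A; rewrite zA => cA.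
rewrite (@leq_trans #|A :\ z|) //; first by lia.
apply/subset_leq_card/subsetP=> y; rewrite !inE => /andP[yz yA].
by rewrite /color_adj eq_sym yz mono ?eqxx // eq_sym.
Qed.

Hypothesis col_surj : forall a, exists x y, x != y /\ col x y = a.
Hypothesis colors4 : 3 < #|C|.

Lemma dominant_or_mono_rest :
    (forall a b c d e, uniq [:: a; b; c; d; e] ->
      ~~ uniq [:: col a b; col b c; col c d; col d e]) -> 7 < #|V| ->
  (exists a, dominant_color a) \/
  (exists (T : {set V}) a, #|T| <= 6 /\ monochromatic_on (~: T) a).
Proof.
move=> noP5 V8.
pose H i j := (i != j) && [exists u, exists x, exists y,
  [&& u != x, u != y, col u x == i & col u y == j]].
have HP i j : reflect (i != j /\ exists u x y,
    [/\ u != x, u != y, col u x = i & col u y = j]) (H i j).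
  apply: (iffP andP) => -[ij].
    case/existsP=> u /existsP[x /existsP[y /and4P[ux uy /eqP ci /eqP cj]]].
    by split=> //; exists u, x, y.
  case=> u [x [y [ux uy ci cj]]]; split=> //.
  apply/existsP; exists u; apply/existsP; exists x; apply/existsP; exists y.
  by rewrite ux uy ci cj !eqxx.
have symH : symmetric H.
  suff sub i j : H i j -> H j i by move=> i j; apply/idP/idP; apply: sub.
  case/HP=> ij [u [x [y [ux uy ci cj]]]]; apply/HP.
  by split; [rewrite eq_sym | exists u, y, x].
have irrH : irreflexive H by move=> i; rewrite /H eqxx.
have nbrH i : exists j, H i j.
  have [j ij] : exists j, j != i.
    have /card_gt0P[j] : 0 < #|predC1 i| by have := cardC1 i; lia.
    by rewrite inE; exists j.
  (* Every color lies in a cherry: an edge joining one of color [i] to one of color [j] differs in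
     color from at least one of them. *)
  have [x [y [xy cxy]]] := col_surj i; have [z [w [zw czw]]] := col_surj j.
  have [xw|xw] := eqVneq x w.
    exists j; apply/HP; split; first by rewrite eq_sym.
    by exists x, y, z; split=> //; rewrite xw 1?eq_sym // colC.
  have [cxw|cxw] := eqVneq (col x w) i; last first.
    exists (col x w); apply/HP; split; first by rewrite eq_sym.
    by exists x, y, w.
  exists j; apply/HP; split; first by rewrite eq_sym.
  by exists w, x, z; split; rewrite 1?[col w _]colC // eq_sym.
have [Hdisj | ] := boolP [forall i, forall j, forall k, forall l,
    H i j ==> H k l ==> ~~ uniq [:: i; j; k; l]].
  left; have [|a Ha] := intersecting_rel_star symH irrH nbrH colors4.
    move=> i j k l Hij Hkl.
    have /forallP/(_ j)/forallP/(_ k)/forallP/(_ l) := (forallP Hdisj) i.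
    by rewrite Hij Hkl.
  by exists a => u x y ux uy cxy; apply: Ha; apply/HP; split=> //; exists u, x, y.
move=> Hmatch; right.
have {Hmatch} [i [j [k [l [Hij Hkl ijkl]]]]] : exists i j k l,
    [/\ H i j, H k l & uniq [:: i; j; k; l]].
  case/forallPn: Hmatch => i /forallPn[j /forallPn[k /forallPn[l]]].
  rewrite negb_imply => /andP[Hij]; rewrite negb_imply => /andP[Hkl /negbNE].
  by exists i, j, k, l.
case/HP: Hij => _ [u [x [y [ux uy ci cj]]]].
case/HP: Hkl => _ [v [z [w [vz vw ck cl]]]]; subst i j k l.
pose T := [set:: [:: u; x; y; v; z; w]].
have cT : #|T| <= 6 by rewrite cardsE (leq_trans (card_size _)).
have mono p q r : uniq [:: p; q; r] -> p \notin T -> q \notin T -> r \notin T ->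
    col p q = col p r.
  move=> pqr; rewrite !(in_set, inE) => pT qT rT.
  apply: (cherries_mono_outside colC noP5 ux uy vz vw ijkl pqr).
  by rewrite /= !inE pT qT rT.
(* Outside [T] all edges at a vertex agree, so the color of one edge [p0 q0] spreads to the whole
   complement. *)
have /card_gt1P[p0 [q0 [p0T q0T pq0]]] : 1 < #|~: T|.
  by rewrite cardsCs setCK; lia.
rewrite !in_setC in p0T q0T.
have colp0 p : p \notin T -> p != p0 -> col p0 p = col p0 q0.
  move=> pT pp0; have [-> // | pq] := eqVneq p q0.
  by apply: mono => //; rewrite /= !inE negb_or eq_sym pp0 pq0 pq.
exists T, (col p0 q0); split=> // p q; rewrite !in_setC => pT qT pq.
have [ep | pp0] := eqVneq p p0; first by subst p; apply: colp0; rewrite // eq_sym.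
have [-> | qp0] := eqVneq q p0; first by rewrite colC colp0.
by rewrite (mono p q p0) ?colp0 1?colC ?colp0 //= !inE negb_or pq pp0 qp0.
Qed.

Lemma dominant_pineapple t a :
    dominant_color a -> #|C| <= t -> #|C|.-1 * t.-1 < #|V| ->
  exists b, pineapple_witness t #|C| b.
Proof.
move=> dom Ct Vgt.
(* [g x] is the color other than [a] seen at [x], if any; [dom] makes it unique, so the fibers of
   [g] are the sets V(j). *)
pose g x := [pick j | (j != a) && [exists y, (x != y) && (col x y == j)]].
have gP x y : x != y -> col x y != a -> g x = Some (col x y).
  move=> xy cxy; rewrite /g; case: pickP => [j | /(_ (col x y))]; last first.
    by rewrite cxy /= => /existsP[]; exists y; rewrite xy eqxx.
  case/andP=> /eqP ja /existsP[z /andP[xz /eqP cxz]]; congr Some; apply/eqP.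
  rewrite eq_sym -cxz; apply: contraNT cxy => cyz.
  by have [-> //|] := dom x y z xy xz cyz; rewrite cxz => /ja.
have gadj x y : g x != g y -> color_adj a x y.
  move=> gxy; have xy : x != y by apply: contraNneq gxy => ->.
  rewrite /color_adj xy; apply: contraNT gxy => cxy.
  by rewrite (gP x y) // (gP y x) 1?colC // eq_sym.
have clique s : uniq (map g s) -> pairwise (color_adj a) s.
  by rewrite uniq_pairwise pairwise_map; apply: sub_pairwise.
(* [r j] represents V(j); representatives of distinct colors are joined in color [a]. *)
have [r rP] : exists r : C -> V, forall j, j != a -> g (r j) = Some j.
  apply: (fin_all_exists (P := fun j x => j != a -> g x = Some j)) => j.
  by have [x [y [xy <-]]] := col_surj j; exists x => /(gP _ _ xy).
have gr (s : seq C) : a \notin s -> map g (map r s) = map Some s.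
  by move=> /memPn sa; rewrite -map_comp; apply/eq_in_map => j /sa /rP.
(* If all edges at [v] have color [a], then [v] and one representative of each other color form the
   clique, with center [v]. *)
have [[v gv] | allSome] : (exists v, g v = None) \/ forall v, g v != None.
  have [/existsP[v /eqP] | /existsPn] := boolP [exists v, g v == None]; last by right.
  by left; exists v.
  exists a, v, (map r (enum (predC1 a))); split.
  - by rewrite size_map -cardE cardC1.
  - apply: clique; rewrite map_cons gv gr ?mem_enum ?inE ?eqxx //=.
    by rewrite map_inj_uniq ?enum_uniq ?andbT; [apply/mapP=> -[] | move=> ? ? []].
  rewrite (@leq_trans #|predC1 v|) //; first by rewrite cardC1; nia.
  apply/subset_leq_card/subsetP=> y; rewrite !inE => yv.
  rewrite /color_adj eq_sym yv; apply/eqP/eqP; apply: contraT => cvy.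
  by move: gv; rewrite (gP v y) // eq_sym.
have gNa v : g v != Some a.
  by rewrite /g; case: pickP => // j /andP[ja _]; apply: contra ja => /eqP[->].
have [j ja tj] : exists2 j, j != a & t <= #|[set x | g x == Some j]|.
  have [/existsP[j /andP[]] | /existsPn small] :=
    boolP [exists j, (j != a) && (t <= #|[set x | g x == Some j]|)]; first by exists j.
  exfalso; suff : #|V| <= #|C|.-1 * t.-1 by lia.
  (* By [allSome] and [gNa] the fibers of [g] are indexed by the colors other than [a]; with fewer
     than [t] vertices each they could not cover [V]. *)
  rewrite -sum1_card (partition_big (fun x => odflt a (g x)) (predC1 a)) /=; last first.
    by move=> x _; have := gNa x; have := allSome x; case: (g x).
  rewrite -(cardC1 a) -sum_nat_const leq_sum // => j ja.
  have := small j; rewrite ja /= -ltnNge => lt_t.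
  apply: leq_trans (_ : _ <= #|[set x | g x == Some j]|) _; last by lia.
  rewrite sum1_card subset_leq_card //; apply/subsetP=> x; rewrite inE unfold_in.
  by have := allSome x; case: (g x) => // b _ /eqP ->.
set P := [set x | _] in tj.
have [mono | /forall_inPn[x xP /forall_inPn[y yP]]] :=
  boolP [forall x in P, forall y in P, (x != y) ==> (col x y == j)].
  exists j; apply: (mono_set_pineapple (A := P)) => //; last by lia.
  move=> x y xP yP xy; apply/eqP.
  by move/forall_inP/(_ x xP)/forall_inP/(_ y yP)/implyP/(_ xy): mono.
rewrite negb_imply => /andP[xy cxy].
have {cxy} adj_xy : color_adj a x y.
  rewrite /color_adj xy; apply: contraNT cxy => cxy.
  by move: xP; rewrite inE (gP x y) // => /eqP[->].
move: xP yP; rewrite !inE => /eqP gx /eqP gy.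
have Duniq := enum_uniq ([predD1 predC1 a & j]).
have Dmem i : i \in enum [predD1 predC1 a & j] -> i != a /\ i != j.
  by rewrite mem_enum !inE => /andP[].
have Dsize : (size (enum [predD1 predC1 a & j])).+2 = #|C|.
  have := cardC1 a; rewrite -cardE (cardD1 j (predC1 a)) inE ja.
  by case: #|C| colors4 => //= n _ <-.
(* V(j) contains an edge [x y] of color [a]. The clique consists of [x], [y] and one representative
   of each color other than [a] and [j]. Its center is [r i] with [i] such a color, joined in color
   [a] to all of V(j), hence to at least [t] vertices. *)
case: (enum _) Duniq Dmem Dsize => [|i s] Duniq Dmem Dsize.
  by move: colors4; rewrite -Dsize.
have [ia ij] := Dmem i (mem_head _ _).
have rest z : g z = Some j -> pairwise (color_adj a) (r i :: z :: map r s).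
  move=> gz; apply: clique; rewrite /= rP // gz gr.
    have : uniq (map Some (i :: j :: s)); last by [].
    rewrite map_inj_uniq => [|? ? [] //]; move: Duniq => /= /andP[si ->].
    rewrite inE negb_or ij si /= andbT; apply/negP=> js.
    by have [] := Dmem j; rewrite ?inE ?js ?orbT // eqxx.
  by apply/negP=> sa; have [] := Dmem a; rewrite ?inE ?sa ?orbT // eqxx.
exists a, (r i), [:: x, y & map r s]; split.
- by rewrite -Dsize /= size_map.
- have := rest x gx; have := rest y gy; rewrite /= adj_xy.
  by case/and3P=> /andP[-> _] -> -> /and3P[/andP[-> ->] ->].
rewrite (leq_trans _ (leq_trans tj _)) ?leq_pred //.
apply/subset_leq_card/subsetP=> z; rewrite !inE => /eqP gz; apply: gadj.
by rewrite rP // gz; apply: contra ij => /eqP[->].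
Qed.

End GallaiRamsey.

(** * From embeddings of graphs to lists of vertices *)

Lemma edges_adj (G : sgraph) (x y : G) : adj x y -> [set x; y] \in edges G.
Proof.
move=> xy; rewrite inE; apply/existsP; exists x; apply/existsP; exists y.
by rewrite xy eqxx.
Qed.

Lemma edgesP (G : sgraph) (e : {set G}) :
  e \in edges G -> exists x y, adj x y /\ e = [set x; y].
Proof.
by rewrite inE => /existsP[x /existsP[y /andP[xy /eqP ->]]]; exists x, y.
Qed.

Lemma imset_pair (aT rT : finType) (f : aT -> rT) x y :
  f @: [set x; y] = [set f x; f y].
Proof. by rewrite imsetU1 imset_set1. Qed.

Definition edge_color n k (c : {set complete_graph n} -> 'I_k)
  (x y : 'I_n) : 'I_k := c [set x; y].

Lemma edge_colorC n k (c : {set complete_graph n} -> 'I_k) x y :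
  edge_color c x y = edge_color c y x.
Proof. by rewrite /edge_color setUC. Qed.

Definition path5_edge i : {set path_graph 5} := [set inord i; inord i.+1].

Lemma edges_path5P (e : {set path_graph 5}) :
  e \in edges (path_graph 5) -> exists2 i, i \in iota 0 4 & e = path5_edge i.
Proof.
case/edgesP=> x [y [/orP[] /eqP xy ->]].
  exists (x : nat); first by rewrite mem_iota /=; have := ltn_ord y; rewrite -xy.
  by rewrite /path5_edge xy !inord_val.
exists (y : nat); first by rewrite mem_iota /=; have := ltn_ord x; rewrite -xy.
by rewrite /path5_edge xy !inord_val setUC.
Qed.

Lemma path5_edge_in i : i \in iota 0 4 -> path5_edge i \in edges (path_graph 5).
Proof.
rewrite mem_iota => /= i4; apply: (@edges_adj (path_graph 5)); apply/orP; left.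
by rewrite !inordK // ltnW.
Qed.

Lemma path5_edge_inj : {in iota 0 4 &, injective path5_edge}.
Proof.
move=> i j; rewrite !mem_iota => /= i4 j4 /setP eij.
have := eij (inord i); have := eij (inord j).
rewrite !inE !eqxx /= -!(inj_eq val_inj) /= !inordK //; lia.
Qed.

Lemma rainbow_path5P n k (c : {set complete_graph n} -> 'I_k) :
  has_rainbow_copy (path_graph 5) c <->
  exists x0 x1 x2 x3 x4, uniq [:: x0; x1; x2; x3; x4] /\
    uniq [:: edge_color c x0 x1; edge_color c x1 x2;
             edge_color c x2 x3; edge_color c x3 x4].
Proof.
split=> [[f [injf _] injc] | [x0 [x1 [x2 [x3 [x4 [Ux Uc]]]]]]].
  exists (f (inord 0)), (f (inord 1)), (f (inord 2)), (f (inord 3)), (f (inord 4)).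
  split.
    have : uniq (map (f \o inord) (iota 0 5)); last by [].
    rewrite map_inj_in_uniq ?iota_uniq // => i j; rewrite !mem_iota => /= i5 j5.
    by move/injf/(congr1 val); rewrite /= !inordK.
  have : uniq (map (fun i => c (f @: path5_edge i)) (iota 0 4)).
    rewrite map_inj_in_uniq ?iota_uniq // => i j i4 j4.
    by move/injc=> /(_ (path5_edge_in i4) (path5_edge_in j4)) /path5_edge_inj ->.
  by rewrite /= /path5_edge !imset_pair.
pose s := [:: x0; x1; x2; x3; x4].
have injf : injective (fun i : 'I_5 => nth x0 s i).
  by move=> i j /eqP; rewrite nth_uniq //= => /eqP/val_inj.
exists (fun i : path_graph 5 => nth x0 s i).
  split=> // x y xy; rewrite /= /complete_adj (inj_eq injf).
  by apply: contraTneq xy => ->; rewrite adj_irr.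
pose s' := [:: edge_color c x0 x1; edge_color c x1 x2;
             edge_color c x2 x3; edge_color c x3 x4].
have cE i : i \in iota 0 4 ->
    c ((fun i : path_graph 5 => nth x0 s i) @: path5_edge i) =
    nth (edge_color c x0 x1) s' i.
  by rewrite mem_iota imset_pair; case: i => [|[|[|[|]]]] //= _; rewrite !inordK.
move=> _ _ /edges_path5P[i i4 ->] /edges_path5P[j j4 ->] /=; rewrite !cE // => /eqP.
by move: i4 j4; rewrite !mem_iota => i4 j4; rewrite nth_uniq // => /eqP ->.
Qed.

Lemma pineapple_mono n k t w (c : {set complete_graph n} -> 'I_k) a :
    0 < w <= t -> pineapple_witness (edge_color c) t w a ->
  has_mono_copy (pineapple t w) c.
Proof.
move=> /andP[w0 wt] [z [K [szK cliq tN]]].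
set N := [set y | _] in tN.
(* The order of [s] follows the numbering of [pineapple t w]: center, rest of the clique, pendent
   vertices. Its first [t] entries give the copy. *)
pose L := [seq y <- enum N | y \notin K]; pose s := z :: K ++ L.
have /andP[zK UK] : (z \notin K) && uniq K.
  by rewrite -cons_uniq uniq_pairwise; apply: sub_pairwise cliq => x y /andP[].
have Us : uniq s.
  rewrite /s /= mem_cat negb_or zK mem_filter mem_enum inE /color_adj eqxx andbF /=.
  rewrite cat_uniq UK filter_uniq ?enum_uniq // andbT /=; apply/hasPn=> y.
  by rewrite mem_filter => /andP[].
have szs : t <= size s.
  have szN : size (enum N) <= size K + size L.
    rewrite -(count_predC [in K] (enum N)) [size L]size_filter leq_add2r -size_filter.
    apply: uniq_leq_size; first by rewrite filter_uniq ?enum_uniq.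
    by move=> y; rewrite mem_filter => /andP[].
  by rewrite -cardE in szN; have := leq_trans tN szN; rewrite /= size_cat; lia.
have adjs i j : i < j < t -> (j < w) || (i == 0) ->
    color_adj (edge_color c) a (nth z s i) (nth z s j).
  move=> /andP[ij jt] ijw; have [jw | wj] := ltnP j w.
    have nthE l : l < w -> nth z s l = nth z (z :: K) l.
      by move=> lw; rewrite /s -cat_cons nth_cat /= szK prednK // lw.
    rewrite !nthE //; last exact: ltn_trans ij jw.
    by move/pairwiseP: cliq => /(_ z); apply; rewrite ?inE /= ?szK; lia.
  have /eqP i0 : i == 0 by move: ijw; rewrite ltnNge wj.
  have jL : nth z s j \in L.
    have -> : nth z s j = nth z L (j - w).
      by rewrite /s -cat_cons nth_cat /= szK prednK // ltnNge wj.
    by apply: mem_nth; move: szs; rewrite /= size_cat szK; lia.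
  by move: jL; rewrite i0 mem_filter mem_enum inE => /andP[].
exists (fun i : pineapple t w => nth z s i); last first.
  exists a => _ /edgesP[x [y [xy ->]]]; rewrite imset_pair.
  have colE u v : color_adj (edge_color c) a u v -> c [set u; v] = a.
    by case/andP=> _ /eqP.
  have [xy' | yx | /val_inj exy] := ltngtP (x : nat) y; last by rewrite exy adj_irr in xy.
    apply/colE/adjs; rewrite ?xy' ?ltn_ord //.
    by move: xy; rewrite /= /pineapple_adj; lia.
  rewrite setUC; apply/colE/adjs; rewrite ?yx ?ltn_ord //.
  by move: xy; rewrite /= /pineapple_adj; lia.
have injf : injective (fun i : 'I_t => nth z s i).
  move=> i j /eqP; rewrite nth_uniq // => [/eqP/val_inj //||];
  exact: leq_trans (ltn_ord _) szs.
split=> // x y xy; rewrite /= /complete_adj (inj_eq injf).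
by apply: contraTneq xy => ->; rewrite adj_irr.
Qed.

(** * The upper bound *)

Lemma gallai_ramsey_upper k t n : 3 < k -> k < t -> k.-1 * t.-1 < n ->
    forall c : {set complete_graph n} -> 'I_k, exact_coloring c ->
  has_rainbow_copy (path_graph 5) c \/ has_mono_copy (pineapple t k) c.
Proof.
move=> k4 kt nbig c exact_c.
have [/existsP[a /existsP[b /existsP[x /existsP[d /existsP[e /andP[? ?]]]]]] | no] :=
  boolP [exists a : 'I_n, exists b : 'I_n, exists x : 'I_n, exists d : 'I_n,
    exists e : 'I_n, uniq [:: a; b; x; d; e] &&
    uniq [:: edge_color c a b; edge_color c b x; edge_color c x d; edge_color c d e]].
  by left; apply/rainbow_path5P; exists a, b, x, d, e.
right.
have noP5 a b x d e : uniq [:: a; b; x; d; e] ->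
    ~~ uniq [:: edge_color c a b; edge_color c b x; edge_color c x d; edge_color c d e].
  move=> U; apply: contra no => U'.
  do 5![apply/existsP; eexists]; apply/andP; split; [exact: U | exact: U'].
have surj a : exists x y, x != y /\ edge_color c x y = a.
  have [_ /edgesP[x [y [xy ->]]] <-] := exact_c a.
  by exists x, y.
have n8 : 7 < #|'I_n| by rewrite card_ord; nia.
have c4 : 3 < #|'I_k| by rewrite card_ord.
have [[a dom] | [T [a [cT mono]]]] :=
  dominant_or_mono_rest (@edge_colorC _ _ c) surj c4 noP5 n8.
  have [||b] := dominant_pineapple (@edge_colorC _ _ c) surj c4 dom (t := t).
  - by rewrite card_ord ltnW.
  - by rewrite !card_ord.
  by rewrite card_ord => wit; apply: pineapple_mono wit; lia.
apply: (@pineapple_mono _ _ _ _ c a); first lia.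
apply: (mono_set_pineapple mono); first lia.
(* At least [n - 6] vertices lie outside [T], and [n >= 3 * (t - 1) + 1] with [t >= 5] makes this at
   least [t]. *)
by have := cardsC T; rewrite card_ord; nia.
Qed.

(** * The lower bound coloring, with [m = k - 1] blocks of size [s = t - 1] *)

Section BalancedColoring.

Variables m s : nat.
Hypotheses (m2 : 1 < m) (s2 : 1 < s).

Let s0 : 0 < s. Proof. exact: ltnW. Qed.

Definition block (q : 'I_m) : {set 'I_(m * s)} :=
  [set i : 'I_(m * s) | i %/ s == q :> nat].

(* The color [lift ord0 q] is that of block [q]; [ord0] is used between blocks. *)
Definition balanced_coloring (e : {set complete_graph (m * s)}) : 'I_m.+1 :=
  if [pick q | e \subset block q] is Some q then lift ord0 q else ord0.

Lemma balanced_block x y q :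
  edge_color balanced_coloring x y = lift ord0 q <-> x \in block q /\ y \in block q.
Proof.
have sub p : [set x; y] \subset block p = (x \in block p) && (y \in block p).
  by rewrite subUset !sub1set.
rewrite /edge_color /balanced_coloring; case: pickP => [p | nop].
  rewrite sub => /andP[xp yp]; split=> [/lift_inj <- // | [xq _]].
  move: xp xq; rewrite !inE => /eqP -> /eqP pq.
  by congr lift; apply/val_inj.
by split=> // -[xq yq]; have := nop q; rewrite sub xq yq.
Qed.

Lemma balanced_cross x y :
  edge_color balanced_coloring x y = ord0 -> x %/ s != y %/ s.
Proof.
move=> c0; apply/eqP=> xy.
have xs : x %/ s < m by rewrite ltn_divLR.
have : edge_color balanced_coloring x y = lift ord0 (Ordinal xs).
  by apply/balanced_block; rewrite !inE /= xy eqxx.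
by rewrite c0.
Qed.

Lemma balanced_exact : exact_coloring balanced_coloring.
Proof.
move=> a; have bound q r : q < m -> r < s -> q * s + r < m * s by nia.
have edgeI (x y : 'I_(m * s)) : x != y -> [set x; y] \in edges (complete_graph (m * s)).
  by move=> xy; apply: (@edges_adj (complete_graph (m * s))).
have [q -> | ->] := unliftP ord0 a.
  (* The first two vertices of block [q] realize its color; the first vertices of blocks 0 and 1
     realize [ord0]. *)
  pose x := Ordinal (bound q 0 (ltn_ord q) s0).
  pose y := Ordinal (bound q 1 (ltn_ord q) s2).
  exists [set x; y]; first by apply: edgeI; rewrite -(inj_eq val_inj) /=; lia.
  by apply/balanced_block; rewrite !inE /= !divnMDl // !divn_small // addn0 eqxx.
pose x := Ordinal (bound 0 0 (ltnW m2) s0).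
pose y := Ordinal (bound 1 0 m2 s0).
exists [set x; y]; first by apply: edgeI; rewrite -(inj_eq val_inj) /=; lia.
rewrite -/(edge_color balanced_coloring x y).
have [q /balanced_block[] | //] := unliftP ord0 (edge_color balanced_coloring x y).
by rewrite !inE /= !divnMDl // !divn_small // => /eqP <-.
Qed.

(** Consecutive edges inside blocks lie in the same block. So in a rainbow P5 one of the first two
    edges and one of the last two would both have color [ord0]. *)
Lemma balanced_no_rainbow : ~ has_rainbow_copy (path_graph 5) balanced_coloring.
Proof.
case/rainbow_path5P=> a [b [x [d [e [_ U]]]]].
have cherry u v w :
    edge_color balanced_coloring u v != edge_color balanced_coloring v w ->
    edge_color balanced_coloring u v = ord0 \/ edge_color balanced_coloring v w = ord0.
  have [p cuv | -> //] := unliftP ord0 (edge_color balanced_coloring u v); last by left.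
  have [q cvw | -> //] := unliftP ord0 (edge_color balanced_coloring v w); last by right.
  case/eqP; rewrite cuv cvw; congr lift; apply/val_inj.
  move/balanced_block: cuv => [_]; move/balanced_block: cvw => [].
  by rewrite !inE => /eqP eq_q _ /eqP eq_p; rewrite /= -eq_p -eq_q.
move: U; rewrite /= !inE !negb_or !andbT -!andbA.
case/and5P=> /cherry abx n2 n3 n4 /andP[n5 /cherry xde]; move: n2 n3 n4 n5.
by case: abx => ->; case: xde => ->; rewrite eqxx.
Qed.

(** A block color would confine all [s.+1] vertices to one block of size [s]; color [ord0] would
    send the [m.+1] clique vertices to distinct blocks among only [m]. *)
Lemma balanced_no_mono : m <= s ->
  ~ has_mono_copy (pineapple s.+1 m.+1) balanced_coloring.
Proof.
move=> ms [f [injf _] [a mono]].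
have edge i j : pineapple_adj m.+1 i j -> edge_color balanced_coloring (f i) (f j) = a.
  move=> ij; rewrite /edge_color -imset_pair mono //.
  exact: (@edges_adj (pineapple s.+1 m.+1)).
have [q aq | a0] := unliftP ord0 a.
  have fq i : f i \in block q.
    (* Every other vertex is adjacent to vertex 0; for vertex 0 itself the edge to vertex 1 is
       used. *)
    have [-> | i0] := eqVneq i ord0.
      have /edge : pineapple_adj m.+1 (ord0 : 'I_s.+1) (inord 1).
        by rewrite /pineapple_adj -(inj_eq val_inj) /= inordK; lia.
      by rewrite aq => /balanced_block[].
    have /edge : pineapple_adj m.+1 ord0 i.
      by rewrite /pineapple_adj eq_sym i0 /=; lia.
    by rewrite aq => /balanced_block[].
  pose h i : 'I_s := Ordinal (ltn_pmod (f i) s0).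
  have injh : injective h.
    move=> i j /(congr1 val) /= eqm; apply/injf/val_inj.
    rewrite /= (divn_eq (f i) s) (divn_eq (f j) s) eqm.
    by have := fq i; have := fq j; rewrite !inE => /eqP -> /eqP ->.
  by have := leq_card _ injh; rewrite !card_ord ltnn.
have fm i : f i %/ s < m by rewrite ltn_divLR.
pose h (i : 'I_m.+1) : 'I_m := Ordinal (fm (@widen_ord m.+1 s.+1 ms i)).
have injh : injective h.
  move=> i j /(congr1 val) /= eqd; apply/eqP; apply: contraT => ij.
  have /edge : pineapple_adj m.+1 (@widen_ord m.+1 s.+1 ms i) (@widen_ord m.+1 s.+1 ms j).
    by rewrite /pineapple_adj -(inj_eq val_inj) /= (inj_eq val_inj) ij !ltn_ord.
  by rewrite a0 => /balanced_cross; rewrite eqd eqxx.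
by have := leq_card _ injh; rewrite !card_ord ltnn.
Qed.

End BalancedColoring.



Theorem theorem4p1 (k t omega : nat) (hkw : k = omega) (hk : 4 <= k)
    (ht : omega + 1 <= t) :
  is_gallai_ramsey k (path_graph 5) (pineapple t omega)
    ((omega - 1) * (t - 1) + 1).
Proof.
subst omega; case: k t hk ht => [|m] [|s]; rewrite ?addn1 ?ltnS //= => m3 ms.
rewrite !subn1 /=; split.
  split=> [|n nbig]; last by apply: gallai_ramsey_upper.
  by rewrite bin2 /=; nia.
(* A smaller bound [M] would apply to [n = m * s], where the balanced coloring refutes it. *)
move=> M [_ bound]; rewrite ltnNge; apply/negP=> Mms.
have [m2 s2] : 1 < m /\ 1 < s by lia.
have [] := bound _ Mms _ (balanced_exact m2 s2).
  exact: balanced_no_rainbow.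
exact/balanced_no_mono/ltnW.
Qed.
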